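(* Consider the linear Gaussian policy-augmented knowledge graph (pKG) model and the permutation-sampling estimator of the predictive Shapley values of the policy parameters described in the context, with state dimension $n$, action dimension $m$, horizon $H$, $Q$ sampled sets of model parameters and $D$ sampled permutations per set. The cost to compute the approximate predictive Shapley values of all policy parameters with value function $g(\mathcal U\mid\pmb w)=\mathbb{E}[Y\mid\pmb\theta_{\mathcal O\setminus\mathcal U}=0;\pmb w]$, using the recursion $$\mathbf R_{1,t}=\left[(\pmb\beta^s_t)^\top+(\pmb\beta^a_t)^\top\pmb\theta_t^\top\right]\mathbf R_{1,t-1},\qquad \mathbf R_{1,0}=\mathbf I,$$ is $O\left(QDH^2(n^4m+n^3m^2)\right)$. For the brute force algorithm without reusing calculations (each $\mathbf R_{1,t}$ is recomputed from its definition as a product of $t$ matrices), the cost is $O\left(QDH^3(n^4m+n^3m^2)\right)$.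
   Context: Linear Gaussian pKG model. States $\pmb s_t\in\mathbb{R}^n$, actions $\pmb a_t\in\mathbb{R}^m$, $t=1,\dots,H$; $\pmb s_1=\pmb s_0+\pmb e_1$ with $\pmb s_0$ fixed; $\pmb s_{t+1}=\pmb\mu^s_{t+1}+(\pmb\beta^s_t)^\top(\pmb s_t-\pmb\mu^s_t)+(\pmb\beta^a_t)^\top(\pmb a_t-\pmb\mu^a_t)+\pmb e_{t+1}$ with $\pmb\beta^s_t\in\mathbb{R}^{n\times n}$, $\pmb\beta^a_t\in\mathbb{R}^{m\times n}$ and $\pmb e=(\pmb e_1,\dots,\pmb e_H)$ a mean-zero Gaussian vector; linear policy $\pmb a_t=\pmb\mu^a_t+\pmb\theta_t^\top(\pmb s_t-\pmb\mu^s_t)$ with $\pmb\theta_t\in\mathbb{R}^{n\times m}$; reward $r_t=m_t+\pmb b_t^\top\pmb a_t+\pmb c_t^\top\pmb s_t$. Model parameters $\pmb w$ are the entries of $\pmb\beta^s_t,\pmb\beta^a_t$ and the covariance of $\pmb e$. Let $\mathbf R_{1,t}=M_tM_{t-1}\cdots M_1$ with $M_j=(\pmb\beta^s_j)^\top+(\pmb\beta^a_j)^\top\pmb\theta_j^\top$, $\mathbf R_{1,0}=\mathbf I$, and $\pmb\alpha_{t}=\pmb b_t^\top\pmb\theta_t^\top+\pmb c_t^\top$. Inputs: $\mathcal O$ is the set of all scalar policy parameters $\theta_t^{ij}$ ($1\le i\le n,1\le j\le m,1\le t\le H$), so $|\mathcal O|=Hnm$. The output $Y$ is a state $\pmb s_{t+1}$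 ($0\le t\le H-1$) or the cumulative reward $\sum_{t=0}^{H-1}r_{t+1}$. The value function $g(\mathcal U\mid\pmb w)$ sets all policy parameters not in $\mathcal U$ to zero; it is evaluated by the closed forms $$\mathbb{E}[\pmb s_{t+1}]=\pmb\mu^s_{t+1}+\mathbf R_{1,t}(\pmb s_0-\pmb\mu^s_1),\qquad \mathbb{E}\Big[\sum_{t=0}^{H-1}r_{t+1}\Big]=\sum_{t=0}^{H-1}\left\{m_{t+1}+\pmb b_{t+1}^\top\pmb\mu^a_{t+1}+\pmb c_{t+1}^\top\pmb\mu^s_{t+1}+\pmb\alpha_{t+1}\mathbf R_{1,t}(\pmb s_0-\pmb\mu^s_1)\right\}$$ evaluated at the modified $\pmb\theta$. Estimator: for sampled model parameters $\pmb w^{(q)}$, $q=1,\dots,Q$, and for each $q$ sampled permutations $\pi^{(d)}$ of $\mathcal O$, $d=1,\dots,D$, one computes $$\widehat{\mathrm{Sh}}(Y\mid o)=\frac1{QD}\sum_{q=1}^Q\sum_{d=1}^D\left[g(P_o(\pi^{(d)})\cup\{o\}\mid\pmb w^{(q)})-g(P_o(\pi^{(d)})\mid\pmb w^{(q)})\right]$$ for all $o\in\mathcal O$, where $P_o(\pi)$ is the set of inputs preceding $o$ in $\pi$. For each $(q,d)$ the value function is evaluated once on each of the $|\mathcal O|+1$ initial segments of $\pi^{(d)}$, independently of the evaluations on the other segments. Cost model: number of arithmetic operations, with the samples given; multiplying a $p\times q$ matrix by a $q\times r$ matrix in the naive way costs $O(pqr)$. *)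

(* Defs.v *)
From HB Require Import structures.
From mathcomp Require Import all_boot all_order all_algebra.
From mathcomp Require Import all_classical all_reals all_analysis.

Set Implicit Arguments.
Unset Strict Implicit.
Unset Printing Implicit Defensive.

Import Order.TTheory GRing.Theory Num.Theory.
Import numFieldNormedType.Exports.

Local Open Scope ring_scope.

(** * The linear Gaussian model

    Time-indexed data are functions of [t : nat]; only the times
    [1 <= t <= H] ever matter. *)

(* The data that are not model parameters. *)
Record pkg (R : realType) (n m : nat) := Pkg {
  s0 : 'cV[R]_n;
  mus : nat -> 'cV[R]_n;
  mua : nat -> 'cV[R]_m;
  theta : nat -> 'M[R]_(n, m);
  rm : nat -> R;
  rb : nat -> 'cV[R]_m;
  rc : nat -> 'cV[R]_n }.

(* The model parameters w; [Sigma s t] is the block Cov(e_s, e_t). *)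
Record params (R : realType) (n m : nat) := Params {
  betas : nat -> 'M[R]_n;
  betaa : nat -> 'M[R]_(m, n);
  Sigma : nat -> nat -> 'M[R]_n }.

(* The input (k, i, j) is the scalar theta_(k+1)^(ij). *)
Notation inputs n m H := ('I_H * 'I_n * 'I_m)%type.

Section Model.
Variables (R : realType) (n m H : nat).

(* The policy in which every parameter outside U is set to zero. *)
Definition theta_on (th : nat -> 'M[R]_(n, m)) (U : {set inputs n m H})
    (t : nat) : 'M[R]_(n, m) :=
  \matrix_(i, j)
    if [exists k : 'I_H, (t == k.+1) && ((k, i, j) \in U)] then th t i j else 0.

Section Trajectory.
Variables (M : pkg R n m) (w : params R n m) (th : nat -> 'M[R]_(n, m)).
Variable e : nat -> 'cV[R]_n.

Definition action (t : nat) (s : 'cV[R]_n) : 'cV[R]_m :=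
  mua M t + (th t)^T *m (s - mus M t).

Fixpoint state (t : nat) : 'cV[R]_n :=
  match t with
  | 0%N => s0 M
  | u.+1 =>
    match u with
    | 0%N => s0 M + e 1%N
    | _ => mus M u.+1 + (betas w u)^T *m (state u - mus M u)
             + (betaa w u)^T *m (action u (state u) - mua M u) + e u.+1
    end
  end.

Definition reward (t : nat) : 'M[R]_1 :=
  (rm M t)%:M + (rb M t)^T *m action t (state t) + (rc M t)^T *m state t.

End Trajectory.

(* [OutState t] is s_(t+1), 0 <= t <= H-1; [OutReward] is the cumulative
   reward. *)
Inductive output := OutState of 'I_H | OutReward.

Definition odim (Y : output) : nat := if Y is OutState _ then n else 1%N.

Definition outcome (M : pkg R n m) (w : params R n m)
    (th : nat -> 'M[R]_(n, m)) (Y : output) (e : nat -> 'cV[R]_n) :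
    'cV[R]_(odim Y) :=
  match Y return 'cV[R]_(odim Y) with
  | OutState t => state M w th e t.+1
  | OutReward => \sum_(t < H) reward M w th e t.+1
  end.

(* [normal_prob] with standard deviation 0 is not the point mass. *)
Definition gaussian_prob (mean sd : R) (A : set R) : \bar R :=
  if sd == 0 then \d_mean A else normal_prob mean sd A.

(* (e_1, ..., e_H) is a mean-zero, possibly degenerate, Gaussian vector with
   covariance Sigma. The square integrability is implied by the Gaussian law;
   it is recorded so that the total operators 'E and covariance are meaningful
   as they stand. *)
Record gaussian_noise d (T : measurableType d) (P : probability T R)
    (S : nat -> nat -> 'M[R]_n) (e : nat -> 'I_n -> {RV P >-> R}) : Prop := {
  noise_gaussian : forall a : 'I_H -> 'I_n -> R, exists mean sd : R,
    forall A : set R, measurable A ->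
      P ((fun x => \sum_(k < H) \sum_(i < n) a k i * e k.+1 i x) @^-1` A)%classic
        = gaussian_prob mean sd A;
  noise_L2 : forall (k : 'I_H) i, (e k.+1 i : T -> R) \in Lfun P 2%:E;
  noise_mean : forall (k : 'I_H) i, ('E_P[e k.+1 i] = 0)%E;
  noise_cov : forall (k l : 'I_H) i j,
    covariance P (e k.+1 i) (e l.+1 j) = (S k.+1 l.+1 i j)%:E }.

(* g(U | w) = E[Y | theta_(O \ U) = 0; w] *)
Definition value_fun (M : pkg R n m) (w : params R n m)
    d (T : measurableType d) (P : probability T R)
    (e : nat -> 'I_n -> {RV P >-> R}) (Y : output) (U : {set inputs n m H}) :
    'cV[R]_(odim Y) :=
  \col_i fine ('E_P[fun x =>
    outcome M w (theta_on (theta M) U) Y (fun t => \col_j e t j x) i ord0])%E.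

(* A permutation of the inputs is the sequence that lists them in order. *)
Definition preceding (s : seq (inputs n m H)) (o : inputs n m H) :
  {set inputs n m H} := [set x | (index x s < index o s)%N].

Definition shapley_estimator (Q D p : nat)
    (g : 'I_Q -> {set inputs n m H} -> 'cV[R]_p)
    (perms : 'I_Q -> 'I_D -> seq (inputs n m H)) (o : inputs n m H) :
    'cV[R]_p :=
  (Q%:R * D%:R)^-1 *: \sum_(q < Q) \sum_(d < D)
    (g q (o |: preceding (perms q d) o) - g q (preceding (perms q d) o)).

End Model.

(** * Computations with a count of arithmetic operations

    A [counted A] is a result together with the number of scalar arithmetic
    operations performed to obtain it. Only [cadd], [csub], [cmul] and [cinv]
    operate on scalars, one operation each; every other computation below is
    composed of these. A result bound by [let!] is paid for once, however often
    it is reused. Copying, transposing, indexing, and selecting or zeroing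
    entries are free. *)

Record counted (A : Type) := Counted { result : A; cost : nat }.

Definition cret A (a : A) : counted A := Counted a 0.

Definition cbind A B (c : counted A) (f : A -> counted B) : counted B :=
  Counted (result (f (result c))) (cost c + cost (f (result c))).

Notation "'let!' x := a 'in' b" := (cbind a (fun x => b))
  (at level 200, x name, a at level 100, b at level 200).

(* Families computed entrywise, each entry by its own run. *)
Definition cmap A B (f : A -> counted B) (s : seq A) : counted (seq B) :=
  Counted [seq result (f x) | x <- s] (\sum_(x <- s) cost (f x))%N.

Definition ctable (I : finType) A (f : I -> counted A) : counted {ffun I -> A} :=
  Counted [ffun i => result (f i)] (\sum_i cost (f i))%N.

Definition cmatrix A p q (f : 'I_p -> 'I_q -> counted A) : counted 'M[A]_(p, q) :=
  Counted (\matrix_(i, j) result (f i j)) (\sum_i \sum_j cost (f i j))%N.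

Section CountedAlgebra.
Variable R : fieldType.

Definition cadd (x y : R) : counted R := Counted (x + y) 1.
Definition csub (x y : R) : counted R := Counted (x - y) 1.
Definition cmul (x y : R) : counted R := Counted (x * y) 1.
Definition cinv (x : R) : counted R := Counted x^-1 1.

Fixpoint csum (s : seq R) : counted R :=
  if s is x :: s' then let! y := csum s' in cadd x y else cret 0.

Definition caddmx p q (A B : 'M[R]_(p, q)) : counted 'M[R]_(p, q) :=
  cmatrix (fun i j => cadd (A i j) (B i j)).

Definition csubmx p q (A B : 'M[R]_(p, q)) : counted 'M[R]_(p, q) :=
  cmatrix (fun i j => csub (A i j) (B i j)).

Definition cscalemx p q (a : R) (A : 'M[R]_(p, q)) : counted 'M[R]_(p, q) :=
  cmatrix (fun i j => cmul a (A i j)).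

Definition cmulmx p q r (A : 'M[R]_(p, q)) (B : 'M[R]_(q, r)) :
    counted 'M[R]_(p, r) :=
  cmatrix (fun i k =>
    let! terms := cmap (fun j => cmul (A i j) (B j k)) (enum 'I_q) in
    csum terms).

Fixpoint csummx p q (s : seq 'M[R]_(p, q)) : counted 'M[R]_(p, q) :=
  if s is A :: s' then let! B := csummx s' in caddmx A B else cret 0.

Fixpoint cprodmx p (s : seq 'M[R]_p) : counted 'M[R]_p :=
  if s is A :: s' then let! B := cprodmx s' in cmulmx A B else cret 1%:M.

End CountedAlgebra.

(** * The algorithms *)

Section Algorithms.
Variables (R : realType) (n m H : nat).
Variables (M : pkg R n m) (w : params R n m) (th : nat -> 'M[R]_(n, m)).

(* (beta^s_t)^T + (beta^a_t)^T theta_t^T *)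
Definition cfactor (t : nat) : counted 'M[R]_n :=
  let! A := cmulmx (betaa w t)^T (th t)^T in
  caddmx (betas w t)^T A.

(* The list R_(1,0), ..., R_(1,t), each entry obtained from the previous one. *)
Fixpoint R_recursive (t : nat) : counted (seq 'M[R]_n) :=
  if t is u.+1 then
    let! Rs := R_recursive u in
    let! F := cfactor u.+1 in
    let! Rt := cmulmx F (last 1%:M Rs) in
    cret (rcons Rs Rt)
  else cret [:: 1%:M].

(* R_(1,t) alone, from its definition as the product of t factors. *)
Definition R_brute (t : nat) : counted 'M[R]_n :=
  let! Fs := cmap cfactor (rev (iota 1 t)) in
  cprodmx Fs.

(* mu^s_(t+1) + R_(1,t) (s_0 - mu^s_1), given R_(1,t) *)
Definition cstate (t : nat) (Rt : 'M[R]_n) : counted 'cV[R]_n :=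
  let! v := csubmx (s0 M) (mus M 1) in
  let! x := cmulmx Rt v in
  caddmx (mus M t.+1) x.

(* m_(t+1) + b_(t+1)^T mu^a_(t+1) + c_(t+1)^T mu^s_(t+1)
     + alpha_(t+1) R_(1,t) (s_0 - mu^s_1), given R_(1,t) *)
Definition creward (t : nat) (Rt : 'M[R]_n) : counted 'M[R]_1 :=
  let! x := cmulmx (rb M t.+1)^T (mua M t.+1) in
  let! y := cmulmx (rc M t.+1)^T (mus M t.+1) in
  let! z := cmulmx (rb M t.+1)^T (th t.+1)^T in
  let! alpha := caddmx z (rc M t.+1)^T in
  let! v := csubmx (s0 M) (mus M 1) in
  let! alphaR := cmulmx alpha Rt in
  let! u := cmulmx alphaR v in
  csummx [:: (rm M t.+1)%:M; x; y; u].

Definition eval_recursive (Y : output H) : counted 'cV[R]_(odim n Y) :=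
  match Y return counted 'cV[R]_(odim n Y) with
  | OutState t =>
      let! Rs := R_recursive t in
      cstate t (last 1%:M Rs)
  | OutReward =>
      let! Rs := R_recursive H.-1 in
      let! rs := cmap (fun t => creward t (nth 1%:M Rs t)) (iota 0 H) in
      csummx rs
  end.

Definition eval_brute (Y : output H) : counted 'cV[R]_(odim n Y) :=
  match Y return counted 'cV[R]_(odim n Y) with
  | OutState t =>
      let! Rt := R_brute t in
      cstate t Rt
  | OutReward =>
      let! rs := cmap (fun t => let! Rt := R_brute t in creward t Rt)
                      (iota 0 H) in
      csummx rs
  end.

End Algorithms.

Section Shapley.
Variables (R : realType) (n m H Q D p : nat).
Local Notation O := (inputs n m H).
Variable eval : 'I_Q -> {set O} -> counted 'cV[R]_p.

(* One evaluation on each of the |O| + 1 initial segments of the permutation,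
   then the marginal contribution of every input. *)
Definition marginals (q : 'I_Q) (s : seq O) : counted {ffun O -> 'cV[R]_p} :=
  let! vals := cmap (fun k => eval q [set x in take k s]) (iota 0 (size s).+1) in
  ctable (fun o =>
    csubmx (nth 0 vals (index o s).+1) (nth 0 vals (index o s))).

Definition shapley_algorithm (perms : 'I_Q -> 'I_D -> seq O) :
    counted {ffun O -> 'cV[R]_p} :=
  let! deltas := ctable (fun qd : 'I_Q * 'I_D =>
                   marginals qd.1 (perms qd.1 qd.2)) in
  let! QD := cmul Q%:R D%:R in
  let! c := cinv QD in
  ctable (fun o =>
    let! total := csummx [seq deltas qd o | qd <- enum {: 'I_Q * 'I_D}] in
    cscalemx c total).

End Shapley.

Definition shapley_recursive (R : realType) (n m H Q D : nat)
    (M : pkg R n m) (w : 'I_Q -> params R n m) (Y : output H) :=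
  @shapley_algorithm R n m H Q D (odim n Y)
    (fun q U => eval_recursive M (w q) (theta_on (theta M) U) Y).

Definition shapley_brute (R : realType) (n m H Q D : nat)
    (M : pkg R n m) (w : 'I_Q -> params R n m) (Y : output H) :=
  @shapley_algorithm R n m H Q D (odim n Y)
    (fun q U => eval_brute M (w q) (theta_on (theta M) U) Y).

(* Main.v *)
Require Import Defs.
From HB Require Import structures.
From mathcomp Require Import all_boot all_order all_algebra.
From mathcomp Require Import all_classical all_reals all_analysis.
From mathcomp Require Import zify.

(* The noise has mean zero and both the dynamics and the policy are affine, so
   taking expectations along the recursion for the states yields the closed
   forms; square integrability of the noise makes every state integrable.

   One evaluation of the value function costs O(H n^2 (n + m)) when the list
   R_(1,0), ..., R_(1,H-1) is built once. Computing a single R_(1,t) from its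
   definition costs exactly as much as computing R_(1,0), ..., R_(1,t)
   recursively, so the brute force only loses a factor H, and only for the
   cumulative reward, where it computes each of the H products separately. A
   permutation has Hnm + 1 = O(Hnm) initial segments, and the subtractions and
   the averaging cost no more than the evaluations, which gives
   QD * Hnm * H n^2 (n + m), respectively QD * Hnm * H^2 n^2 (n + m). *)

Set Implicit Arguments.
Unset Strict Implicit.
Unset Printing Implicit Defensive.

Import Order.TTheory GRing.Theory Num.Theory.

Local Open Scope ring_scope.

(** * Results and exact costs of the counted scalar and matrix operations *)

Section CountedOperations.
Variable R : fieldType.

Lemma result_csum (s : seq R) : result (csum s) = \sum_(x <- s) x.
Proof. by elim: s => [|x s IH] /=; rewrite ?big_nil // big_cons IH. Qed.

Lemma cost_csum (s : seq R) : cost (csum s) = size s.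
Proof. by elim: s => //= x s ->; rewrite addn1. Qed.

Lemma cost_cmatrix_const A p q (f : 'I_p -> 'I_q -> counted A) c :
  (forall i j, cost (f i j) = c) -> cost (cmatrix f) = (p * q * c)%N.
Proof.
move=> fc; rewrite /= (eq_bigr (fun=> q * c)%N) => [|i _].
  by rewrite sum_nat_const card_ord mulnA.
by rewrite (eq_bigr (fun=> c)) ?sum_nat_const ?card_ord.
Qed.

Lemma result_caddmx p q (A B : 'M[R]_(p, q)) : result (caddmx A B) = A + B.
Proof. by apply/matrixP => i j; rewrite !mxE. Qed.

Lemma cost_caddmx p q (A B : 'M[R]_(p, q)) : cost (caddmx A B) = (p * q)%N.
Proof. by rewrite (cost_cmatrix_const (c := 1)) ?muln1. Qed.

Lemma result_csubmx p q (A B : 'M[R]_(p, q)) : result (csubmx A B) = A - B.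
Proof. by apply/matrixP => i j; rewrite !mxE. Qed.

Lemma cost_csubmx p q (A B : 'M[R]_(p, q)) : cost (csubmx A B) = (p * q)%N.
Proof. by rewrite (cost_cmatrix_const (c := 1)) ?muln1. Qed.

Lemma result_cscalemx p q a (A : 'M[R]_(p, q)) : result (cscalemx a A) = a *: A.
Proof. by apply/matrixP => i j; rewrite !mxE. Qed.

Lemma cost_cscalemx p q a (A : 'M[R]_(p, q)) :
  cost (cscalemx a A) = (p * q)%N.
Proof. by rewrite (cost_cmatrix_const (c := 1)) ?muln1. Qed.

Lemma result_cmulmx p q r (A : 'M[R]_(p, q)) (B : 'M[R]_(q, r)) :
  result (cmulmx A B) = A *m B.
Proof.
by apply/matrixP => i k; rewrite !mxE /= result_csum big_map big_enum.
Qed.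

(** Each entry takes [q] multiplications and [q] additions, since [csum] also adds its last term to
    0. *)
Lemma cost_cmulmx p q r (A : 'M[R]_(p, q)) (B : 'M[R]_(q, r)) :
  cost (cmulmx A B) = (p * r * (2 * q))%N.
Proof.
apply: cost_cmatrix_const => i k /=.
by rewrite cost_csum size_map size_enum_ord sum1_size size_enum_ord addnn mul2n.
Qed.

Lemma result_csummx p q (s : seq 'M[R]_(p, q)) :
  result (csummx s) = \sum_(A <- s) A.
Proof.
elim: s => [|A s IH]; first by rewrite big_nil.
by rewrite big_cons -IH -result_caddmx.
Qed.

Lemma cost_csummx p q (s : seq 'M[R]_(p, q)) :
  cost (csummx s) = (size s * (p * q))%N.
Proof.
elim: s => // A s IH.
rewrite [LHS]/(cost (csummx s) + cost (caddmx A _))%N cost_caddmx IH.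
by rewrite mulSn addnC.
Qed.

Lemma result_cprodmx_cons p A (s : seq 'M[R]_p) :
  result (cprodmx (A :: s)) = A *m result (cprodmx s).
Proof. by rewrite -result_cmulmx. Qed.

(** The product with the final identity is charged too, so [t] factors take [t] multiplications,
    just as in the recursion started from the identity. *)
Lemma cost_cprodmx p (s : seq 'M[R]_p) :
  cost (cprodmx s) = (size s * (2 * p ^ 3))%N.
Proof.
elim: s => // A s IH.
rewrite [LHS]/(cost (cprodmx s) + cost (cmulmx A _))%N cost_cmulmx IH /=; lia.
Qed.

End CountedOperations.

Lemma result_bind A B (c : counted A) (f : A -> counted B) :
  result (cbind c f) = result (f (result c)).
Proof. by []. Qed.

Lemma cost_bind A B (c : counted A) (f : A -> counted B) :
  cost (cbind c f) = (cost c + cost (f (result c)))%N.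
Proof. by []. Qed.

Lemma cost_cmap_const A B (f : A -> counted B) s c :
  (forall x, cost (f x) = c) -> cost (cmap f s) = (size s * c)%N.
Proof.
move=> fc; rewrite /= (eq_bigr (fun=> c)) => [|x _]; last exact: fc.
by rewrite big_const_seq count_predT iter_addn_0 mulnC.
Qed.

(** The bound is asked on members of [s] only: the cost of [R_brute] at [t] grows with [t] and is
    controlled only for [t < H]. *)
Lemma leq_cost_cmap (A : eqType) B (f : A -> counted B) s c :
  {in s, forall x, (cost (f x) <= c)%N} -> (cost (cmap f s) <= size s * c)%N.
Proof.
move=> fc; rewrite /= big_seq mulnC -iter_addn_0 -(count_predT s).
rewrite -big_const_seq [leqRHS]big_seq; exact: leq_sum.
Qed.

Lemma leq_cost_ctable (I : finType) A (f : I -> counted A) c :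
  (forall i, (cost (f i) <= c)%N) -> (cost (ctable f) <= #|I| * c)%N.
Proof. by move=> fc; rewrite -sum_nat_const; apply: leq_sum => i _. Qed.

(** * Closed forms, and correctness and cost of one evaluation of the value function *)

Section ClosedForm.
Variables (R : realType) (n m H : nat).
Variables (M : pkg R n m) (w : params R n m) (th : nat -> 'M[R]_(n, m)).

Fixpoint Rmx (t : nat) : 'M[R]_n :=
  if t is u.+1 then
    ((betas w u.+1)^T + (betaa w u.+1)^T *m (th u.+1)^T) *m Rmx u
  else 1%:M.

(** The index is shifted: this is the expectation of the state at time [t.+1], and likewise for
    [mean_reward]. *)
Definition mean_state (t : nat) : 'cV[R]_n :=
  mus M t.+1 + Rmx t *m (s0 M - mus M 1).

Lemma mean_stateB t : mean_state t - mus M t.+1 = Rmx t *m (s0 M - mus M 1).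
Proof. by rewrite /mean_state addrC addKr. Qed.

Definition mean_reward (t : nat) : 'M[R]_1 :=
  (rm M t.+1)%:M + (rb M t.+1)^T *m mua M t.+1 + (rc M t.+1)^T *m mus M t.+1
  + ((rb M t.+1)^T *m (th t.+1)^T + (rc M t.+1)^T) *m Rmx t
      *m (s0 M - mus M 1).

Definition mean_outcome (Y : output H) : 'cV[R]_(odim n Y) :=
  match Y return 'cV[R]_(odim n Y) with
  | OutState t => mean_state t
  | OutReward => \sum_(t < H) mean_reward t
  end.

Lemma result_cfactor t :
  result (cfactor w th t) = (betas w t)^T + (betaa w t)^T *m (th t)^T.
Proof. by rewrite result_bind result_caddmx result_cmulmx. Qed.

Lemma cost_cfactor t : cost (cfactor w th t) = (n ^ 2 * (2 * m + 1))%N.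
Proof. by rewrite cost_bind cost_caddmx cost_cmulmx; lia. Qed.

Lemma result_R_recursive t :
  result (R_recursive w th t) = rcons [seq Rmx k | k <- iota 0 t] (Rmx t).
Proof.
elim: t => // t IH; rewrite !result_bind result_cmulmx result_cfactor IH.
by rewrite last_rcons -[in iota _ t.+1]addn1 iotaD map_cat cats1.
Qed.

Lemma last_R_recursive t : last 1%:M (result (R_recursive w th t)) = Rmx t.
Proof. by rewrite result_R_recursive last_rcons. Qed.

Lemma nth_R_recursive t k :
  (k <= t)%N -> nth 1%:M (result (R_recursive w th t)) k = Rmx k.
Proof.
rewrite result_R_recursive nth_rcons size_map size_iota leq_eqVlt.
case/predU1P => [->|kt]; first by rewrite ltnn eqxx.
by rewrite kt (nth_map 0%N) ?size_iota// nth_iota.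
Qed.

Lemma cost_R_recursive t :
  cost (R_recursive w th t) = (t * (n ^ 2 * (2 * m + 1) + 2 * n ^ 3))%N.
Proof.
elim: t => // t IH.
by rewrite cost_bind IH cost_bind cost_cfactor cost_bind cost_cmulmx /=; lia.
Qed.

Lemma result_R_brute t : result (R_brute w th t) = Rmx t.
Proof.
rewrite result_bind; elim: t => // t IH.
(* Splitting off the end of the [iota] exposes, after [rev], the leftmost factor of the product, the
   one that [Rmx] multiplies by. *)
rewrite -[t.+1 in LHS]addn1 iotaD rev_cat [LHS]result_cprodmx_cons.
by rewrite result_cfactor IH add1n.
Qed.

Lemma cost_R_brute t :
  cost (R_brute w th t) = (t * (n ^ 2 * (2 * m + 1) + 2 * n ^ 3))%N.
Proof.
rewrite cost_bind cost_cprodmx (cost_cmap_const _ cost_cfactor).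
by rewrite [size (result _)]size_map size_rev size_iota -mulnDr.
Qed.

Lemma result_cstate t : result (cstate M t (Rmx t)) = mean_state t.
Proof. by rewrite !result_bind result_caddmx result_cmulmx result_csubmx. Qed.

Lemma cost_cstate t Rt : cost (cstate M t Rt) = (2 * n + 2 * n ^ 2)%N.
Proof. by rewrite !cost_bind cost_csubmx cost_cmulmx cost_caddmx; lia. Qed.

Lemma result_creward t : result (creward M th t (Rmx t)) = mean_reward t.
Proof.
(* Seven binds and no more: csummx itself unfolds to a bind. *)
rewrite 7!result_bind result_csummx !result_cmulmx result_caddmx result_csubmx.
by rewrite !big_cons big_nil addr0 !addrA.
Qed.

Lemma cost_creward t Rt :
  cost (creward M th t Rt) = (2 * m + 2 * n * m + 2 * n ^ 2 + 6 * n + 4)%N.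
Proof.
by rewrite 7!cost_bind cost_csummx cost_csubmx !cost_cmulmx cost_caddmx /=; lia.
Qed.

Lemma result_csummx_iota (f : nat -> counted 'M[R]_1) :
  result (csummx (result (cmap f (iota 0 H)))) = \sum_(t < H) result (f t).
Proof.
rewrite result_csummx big_map -[H in iota 0 H]subn0 -/(index_iota 0 H).
by rewrite big_mkord.
Qed.

Lemma result_eval_recursive (Y : output H) :
  (0 < H)%N -> result (eval_recursive M w th Y) = mean_outcome Y.
Proof.
case: Y => [t|] H_gt0; rewrite !result_bind ?last_R_recursive ?result_cstate//.
rewrite result_csummx_iota; apply: eq_bigr => t _.
by rewrite nth_R_recursive ?result_creward// -ltnS prednK.
Qed.

Lemma result_eval_brute (Y : output H) :
  result (eval_brute M w th Y) = mean_outcome Y.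
Proof.
case: Y => [t|]; rewrite !result_bind ?result_R_brute ?result_cstate//.
rewrite result_csummx_iota; apply: eq_bigr => t _.
by rewrite result_bind result_R_brute result_creward.
Qed.

(** * Bounds in terms of n^2 (n + m) *)

Lemma leq_transition_cost : (0 < m)%N ->
  (n ^ 2 * (2 * m + 1) + 2 * n ^ 3 <= 3 * (n ^ 2 * (n + m)))%N.
Proof. by move=> m_gt0; rewrite expnSr; nia. Qed.

Lemma leq_cost_cstate t Rt : (0 < n)%N -> (0 < m)%N ->
  (cost (cstate M t Rt) <= 4 * (n ^ 2 * (n + m)))%N.
Proof. by move=> n_gt0 m_gt0; rewrite cost_cstate -!mulnn; nia. Qed.

Lemma leq_cost_creward t Rt : (0 < n)%N -> (0 < m)%N ->
  (cost (creward M th t Rt) <= 20 * (n ^ 2 * (n + m)))%N.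
Proof.
move=> n_gt0 m_gt0; rewrite cost_creward.
(* Every monomial of the cost is at most n^2 m and the coefficients add up to 16, so 20 leaves
   room. *)
have le_n : (n <= n ^ 2)%N by rewrite -mulnn leq_pmulr.
have le_m : (m <= n * m)%N by rewrite leq_pmull.
have le_nm : (n * m <= n ^ 2 * m)%N by rewrite leq_mul2r le_n orbT.
have le_n2 : (n ^ 2 <= n ^ 2 * m)%N by rewrite leq_pmulr.
by rewrite mulnDr; lia.
Qed.

Lemma leq_cost_csummx_iota (f : nat -> counted 'M[R]_1) :
  (cost (csummx (result (cmap f (iota 0 H)))) <= H)%N.
Proof. by rewrite cost_csummx [size _]size_map size_iota !muln1. Qed.

(** The constant is 3 for the list of the R_(1,t), 20 for the rewards and 1 for their sum; a state
    needs only 3 + 4. *)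
Lemma leq_cost_eval_recursive (Y : output H) :
  (0 < n)%N -> (0 < m)%N -> (0 < H)%N ->
  (cost (eval_recursive M w th Y) <= 24 * (H * (n ^ 2 * (n + m))))%N.
Proof.
move=> n_gt0 m_gt0 H_gt0; have := leq_transition_cost m_gt0.
set N := (n ^ 2 * (n + m))%N => le_cF.
have N_gt0 : (0 < N)%N by rewrite /N; lia.
have le_R t : (t < H)%N -> (cost (R_recursive w th t) <= (3 * (H * N)))%N.
  move=> lt_tH; rewrite cost_R_recursive mulnCA; apply: leq_mul => //.
  exact: ltnW.
have le_HN : (H <= H * N)%N by rewrite leq_pmulr.
have le_NHN : (N <= H * N)%N by rewrite leq_pmull.
case: Y => [t|]; rewrite cost_bind.
  apply: leq_trans (leq_add (le_R t (ltn_ord t)) _) _.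
    exact: leq_cost_cstate.
  by rewrite -/N; lia.
rewrite cost_bind.
have le_RH : (cost (R_recursive w th H.-1) <= 3 * (H * N))%N.
  by apply: le_R; rewrite prednK.
set f := fun t => creward _ _ _ _.
have /leq_cost_cmap : {in iota 0 H, forall t, (cost (f t) <= 20 * N)%N}.
  by move=> t _; apply: leq_cost_creward.
rewrite size_iota => le_f.
apply: leq_trans (leq_add le_RH (leq_add le_f (leq_cost_csummx_iota f))) _.
by lia.
Qed.

Lemma leq_cost_eval_brute (Y : output H) :
  (0 < n)%N -> (0 < m)%N -> (0 < H)%N ->
  (cost (eval_brute M w th Y) <= 24 * (H ^ 2 * (n ^ 2 * (n + m))))%N.
Proof.
move=> n_gt0 m_gt0 H_gt0; have := leq_transition_cost m_gt0.
set N := (n ^ 2 * (n + m))%N => le_cF.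
have N_gt0 : (0 < N)%N by rewrite /N; lia.
have le_R t : (t < H)%N -> (cost (R_brute w th t) <= (3 * (H * N)))%N.
  move=> lt_tH; rewrite cost_R_brute mulnCA; apply: leq_mul => //.
  exact: ltnW.
have le_HN : (H <= H * N)%N by rewrite leq_pmulr.
have le_NHN : (N <= H * N)%N by rewrite leq_pmull.
have le_HHN : (H * N <= H ^ 2 * N)%N by rewrite -mulnn -mulnA leq_pmull.
case: Y => [t|]; rewrite cost_bind.
  apply: leq_trans (leq_add (le_R t (ltn_ord t)) _) _.
    exact: leq_cost_cstate.
  by rewrite -/N; lia.
set f := fun t => cbind _ _.
(* 23 is 3 for recomputing R_(1,t) plus 20 for the reward. Only here, over the [H] rewards, does the
   second factor [H] arise. *)
have /leq_cost_cmap : {in iota 0 H, forall t, (cost (f t) <= 23 * (H * N))%N}.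
  move=> t; rewrite mem_iota => /le_R le_Rt; rewrite cost_bind.
  have := leq_cost_creward t (result (R_brute w th t)) n_gt0 m_gt0.
  by rewrite -/N; lia.
rewrite size_iota => le_f.
apply: leq_trans (leq_add le_f (leq_cost_csummx_iota f)) _.
by rewrite -mulnn -mulnA; lia.
Qed.

End ClosedForm.

(** * Correctness and cost of the permutation estimator for an arbitrary evaluator *)

Section Estimator.
Variables (R : realType) (n m H Q D p : nat).
Local Notation O := (inputs n m H).
Variables (eval : 'I_Q -> {set O} -> counted 'cV[R]_p).
Variable perms : 'I_Q -> 'I_D -> seq O.
Hypothesis permsP : forall q k, perm_eq (perms q k) (enum {: O}).

Lemma size_perms q k : size (perms q k) = (H * n * m)%N.
Proof. by rewrite (perm_size (permsP q k)) -cardE !card_prod !card_ord. Qed.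

Lemma take_index (s : seq O) o :
  (forall x, x \in s) -> [set x in take (index o s) s] = preceding s o.
Proof. by move=> sP; apply/setP => x; rewrite !inE in_take. Qed.

Lemma take_indexS (s : seq O) o :
  (forall x, x \in s) ->
  [set x in take (index o s).+1 s] = o |: preceding s o.
Proof.
move=> sP; apply/setP => x; rewrite !inE in_take// ltnS leq_eqVlt.
(* An index determines its element because every input occurs in [s]. *)
by congr orb; apply/eqP/eqP => [/index_inj->|->].
Qed.

Lemma result_marginals q (s : seq O) o : (forall x, x \in s) ->
  result (marginals eval q s) o =
  result (eval q (o |: preceding s o)) - result (eval q (preceding s o)).
Proof.
move=> sP; rewrite result_bind ffunE result_csubmx.
(* Both positions [index o s] and its successor then lie within the [(size s).+1] values, so the
   default 0 is never read. *)
have lt_os : (index o s < size s)%N by rewrite index_mem.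
rewrite !(nth_map 0%N) ?size_iota ?nth_iota// 1?ltnW// !add0n.
by rewrite take_index// take_indexS.
Qed.

Lemma result_shapley_algorithm o :
  result (shapley_algorithm eval perms) o =
  shapley_estimator (fun q U => result (eval q U)) perms o.
Proof.
rewrite !result_bind ffunE result_bind result_cscalemx result_csummx big_map.
rewrite big_enum [RHS]/shapley_estimator pair_bigA.
congr (_ *: _); apply: eq_bigr => -[q k] _ /=.
rewrite ffunE result_marginals// => x.
by rewrite (perm_mem (permsP q k)) mem_enum.
Qed.

(** With I = Hnm > 0, the I + 1 evaluations cost at most 2Ic; the I subtractions of vectors of
    length [p <= c] cost at most Ic. *)
Lemma leq_cost_marginals q k c : (0 < n)%N -> (0 < m)%N -> (0 < H)%N ->
  (p <= c)%N -> (forall q U, cost (eval q U) <= c)%N ->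
  (cost (marginals eval q (perms q k)) <= 3 * (H * n * m * c))%N.
Proof.
move=> n_gt0 m_gt0 H_gt0 le_pc le_evalc; rewrite cost_bind.
set f := fun k => eval q _; set g := fun o => csubmx _ _.
have le_f :
    (cost (cmap f (iota 0 (size (perms q k)).+1)) <= (H * n * m).+1 * c)%N.
  apply: leq_trans (leq_cost_cmap (c := c) _) _ => [i _|].
    exact: le_evalc.
  by rewrite size_iota size_perms.
have le_g : (cost (ctable g) <= (H * n * m) * c)%N.
  apply: leq_trans (leq_cost_ctable (c := c) _) _ => [x|].
    by rewrite cost_csubmx muln1.
  by rewrite !card_prod !card_ord.
have : (c <= H * n * m * c)%N by rewrite leq_pmull// !muln_gt0 H_gt0 n_gt0.
move=> le_c; apply: leq_trans (leq_add le_f le_g) _.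
by rewrite mulSn; lia.
Qed.

(** The 7 splits into 3 for the marginals, 2 for summing and scaling them, and 2 for the two scalar
    operations that form the factor 1/(QD). *)
Lemma leq_cost_shapley_algorithm c : (0 < n)%N -> (0 < m)%N -> (0 < H)%N ->
  (0 < Q)%N -> (0 < D)%N -> (p <= c)%N -> (0 < c)%N ->
  (forall q U, cost (eval q U) <= c)%N ->
  (cost (shapley_algorithm eval perms) <= 7 * (Q * D * (H * n * m) * c))%N.
Proof.
move=> n_gt0 m_gt0 H_gt0 Q_gt0 D_gt0 le_pc c_gt0 le_evalc.
have QD_gt0 : (0 < Q * D)%N by rewrite muln_gt0 Q_gt0.
have I_gt0 : (0 < H * n * m)%N by rewrite !muln_gt0 H_gt0 n_gt0.
rewrite 3!cost_bind.
set deltas := ctable _; set totals := ctable _.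
have le_deltas : (cost deltas <= 3 * (Q * D * (H * n * m) * c))%N.
  apply: leq_trans (leq_cost_ctable (c := 3 * (H * n * m * c)) _) _ => [qk|].
    exact: leq_cost_marginals.
  by rewrite card_prod !card_ord; lia.
have le_totals : (cost totals <= 2 * (Q * D * (H * n * m) * c))%N.
  apply: leq_trans (leq_cost_ctable (c := 2 * (Q * D * c)) _) _ => [x|].
    rewrite cost_bind cost_csummx cost_cscalemx size_map -cardE.
    rewrite card_prod !card_ord !muln1.
    have : (Q * D * p <= Q * D * c)%N by rewrite leq_mul2l le_pc orbT.
    have : (c <= Q * D * c)%N by rewrite leq_pmull.
    by lia.
  by rewrite !card_prod !card_ord; lia.
have : (0 < Q * D * (H * n * m) * c)%N.
  by rewrite muln_gt0 c_gt0 andbT muln_gt0 QD_gt0.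
by move: le_deltas le_totals => /=; lia.
Qed.

End Estimator.

(** * The dynamics under the linear policy, in deviations from the reference means *)

Section Dynamics.
Variables (R : realType) (n m : nat) (M : pkg R n m) (w : params R n m).
Variables (th : nat -> 'M[R]_(n, m)) (e : nat -> 'cV[R]_n).

Lemma action_subr t s : action M th t s - mua M t = (th t)^T *m (s - mus M t).
Proof. by rewrite /action addrC addKr. Qed.

Lemma stateSS t :
  state M w th e t.+2 =
    mus M t.+2 + (betas w t.+1)^T *m (state M w th e t.+1 - mus M t.+1)
    + (betaa w t.+1)^T *m ((th t.+1)^T *m (state M w th e t.+1 - mus M t.+1))
    + e t.+2.
Proof. by rewrite -action_subr. Qed.

End Dynamics.

(** * Expectations of states and rewards *)

Section Expectation.
Variables (R : realType) (d : measure_display) (T : measurableType d).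
Variable P : probability T R.

(** Integrability is carried along with the mean because linearity of ['E_P] requires it. *)
Definition has_mean p q (X : T -> 'M[R]_(p, q)) (A : 'M[R]_(p, q)) :=
  forall i j, (fun x => X x i j) \in Lfun P 1 /\
    ('E_P[fun x => X x i j] = (A i j)%:E)%E.

Lemma has_mean_cst p q (A : 'M[R]_(p, q)) : has_mean (fun=> A) A.
Proof. by move=> i j; rewrite (expectation_cst P (A i j)) Lfun_cst. Qed.

Lemma has_meanD p q (X Y : T -> 'M[R]_(p, q)) A B :
  has_mean X A -> has_mean Y B -> has_mean (fun x => X x + Y x) (A + B).
Proof.
move=> meanX meanY i j; have [LX EX] := meanX i j; have [LY EY] := meanY i j.
have -> : (fun x => (X x + Y x) i j) =
          (fun x => X x i j) \+ (fun x => Y x i j).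
  by apply/funext => x; rewrite mxE.
by rewrite expectationD// EX EY mxE EFinD; split=> //; apply: rpredD.
Qed.

Lemma has_meanZ p q (X : T -> 'M[R]_(p, q)) A a :
  has_mean X A -> has_mean (fun x => a *: X x) (a *: A).
Proof.
move=> meanX i j; have [LX EX] := meanX i j.
have -> : (fun x => (a *: X x) i j) = a \o* (fun x => X x i j).
  by apply/funext => x; rewrite mxE mulrC.
by rewrite expectationZl// EX mxE EFinM; split=> //; apply: Lfun_scale.
Qed.

Lemma has_mean_sum (I : Type) (s : seq I) p q (X : I -> T -> 'M[R]_(p, q)) A :
  (forall i, has_mean (X i) (A i)) ->
  has_mean (fun x => \sum_(i <- s) X i x) (\sum_(i <- s) A i).
Proof.
move=> meanX; elim: s => [|k s IH].
  rewrite big_nil; under eq_fun do rewrite big_nil; exact: has_mean_cst.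
rewrite big_cons; under eq_fun do rewrite big_cons; exact: has_meanD.
Qed.

Lemma has_mean_mulmx p q r (B : 'M[R]_(p, q)) (X : T -> 'M[R]_(q, r)) A :
  has_mean X A -> has_mean (fun x => B *m X x) (B *m A).
Proof.
move=> meanX i j.
(* A row of the product is a linear combination of the rows of [X x], which reduces the claim to
   sums and scalar multiples. *)
have meanBX : has_mean (fun x => \sum_k B i k *: row k (X x))
                       (\sum_k B i k *: row k A).
  apply: has_mean_sum => k; apply: has_meanZ => i' j'.
  by under eq_fun do rewrite mxE; rewrite mxE; apply: meanX.
have [LBX EBX] := meanBX ord0 j.
have eBX (C : 'M[R]_(q, r)) :
    (B *m C) i j = (\sum_k B i k *: row k C) ord0 j.
  by rewrite mxE summxE; apply: eq_bigr => k _; rewrite !mxE.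
by under eq_fun do rewrite eBX; rewrite eBX.
Qed.

Lemma has_meanB_cst p q (X : T -> 'M[R]_(p, q)) A B :
  has_mean X A -> has_mean (fun x => X x - B) (A - B).
Proof. by move=> meanX; apply: has_meanD => //; apply: has_mean_cst. Qed.

Variables (n m H : nat) (M : pkg R n m) (w : params R n m).
Variable e : nat -> 'I_n -> {RV P >-> R}.
Hypothesis eP : gaussian_noise H (Sigma w) e.
Variable th : nat -> 'M[R]_(n, m).
Let noise x t : 'cV[R]_n := \col_j e t j x.

Lemma has_mean_noise (t : 'I_H) : has_mean (fun x => noise x t.+1) 0.
Proof.
move=> i j; rewrite mxE; under eq_fun do rewrite mxE.
split; last exact: (noise_mean eP t i).
(* On a finite measure space, square integrable functions are integrable. *)
by apply: Lfun_subset12 (noise_L2 eP t i); exact: fin_num_measure.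
Qed.

Lemma has_mean_state t : (t < H)%N ->
  has_mean (fun x => state M w th (noise x) t.+1) (mean_state M w th t).
Proof.
elim: t => [|t IH] lt_tH.
  (* The closed form collapses to [s0 M], and the added 0 is the mean of the first noise term. *)
  rewrite /mean_state mul1mx addrC subrK -[s0 M]addr0.
  by apply: has_meanD (has_mean_cst _) (has_mean_noise (Ordinal lt_tH)).
(* The mean is put in the shape of [stateSS], with 0 in place of the noise, so that the two sides
   can be matched term by term. *)
have -> : mean_state M w th t.+1 =
    mus M t.+2 + (betas w t.+1)^T *m (mean_state M w th t - mus M t.+1)
    + (betaa w t.+1)^T *m ((th t.+1)^T *m (mean_state M w th t - mus M t.+1))
    + 0.
  by rewrite mean_stateB [LHS]/mean_state /= !mulmxDl !mulmxA addrA addr0.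
under eq_fun do rewrite stateSS.
have meanB := has_meanB_cst (mus M t.+1) (IH (ltnW lt_tH)).
apply: has_meanD (has_mean_noise (Ordinal lt_tH)).
apply: has_meanD; last by do 2!apply: has_mean_mulmx.
by apply: has_meanD; [exact: has_mean_cst | exact: has_mean_mulmx].
Qed.

Lemma has_mean_reward t : (t < H)%N ->
  has_mean (fun x => reward M w th (noise x) t.+1) (mean_reward M w th t).
Proof.
move=> lt_tH; have meanS := has_mean_state lt_tH.
(* The closed form is regrouped as the reward at the mean state; the reward is affine in the
   state. *)
have -> : mean_reward M w th t =
    (rm M t.+1)%:M
    + (rb M t.+1)^T *m
        (mua M t.+1 + (th t.+1)^T *m (mean_state M w th t - mus M t.+1))
    + (rc M t.+1)^T *m mean_state M w th t.
  rewrite mean_stateB /mean_reward /mean_state.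
  move: (s0 M - mus M 1) => v; rewrite !mulmxDr !mulmxDl !mulmxA.
  by rewrite !addrA; congr (_ + _); rewrite addrAC.
apply: has_meanD; last exact: has_mean_mulmx.
apply: has_meanD; first exact: has_mean_cst.
apply/has_mean_mulmx/has_meanD; first exact: has_mean_cst.
exact/has_mean_mulmx/has_meanB_cst.
Qed.

Lemma has_mean_outcome (Y : output H) :
  has_mean (fun x => outcome M w th Y (noise x)) (mean_outcome M w th Y).
Proof.
case: Y => [t|] /=; first exact: has_mean_state.
by apply: has_mean_sum => t; apply: has_mean_reward.
Qed.

End Expectation.

Lemma value_funE (R : realType) d (T : measurableType d) (P : probability T R)
    n m H (M : pkg R n m) (w : params R n m) (e : nat -> 'I_n -> {RV P >-> R})
    (Y : output H) (U : {set inputs n m H}) :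
  gaussian_noise H (Sigma w) e ->
  value_fun M w e Y U = mean_outcome M w (theta_on (theta M) U) Y.
Proof.
move=> eP; apply/matrixP => i j; rewrite mxE [j]ord1.
by have [_ ->] := has_mean_outcome M eP (theta_on (theta M) U) i ord0.
Qed.

Theorem proposition3 :
  exists C : nat,
  forall (R : realType) (n m H Q D : nat),
  (0 < n)%N -> (0 < m)%N -> (0 < H)%N -> (0 < Q)%N -> (0 < D)%N ->
  forall (M : pkg R n m) (w : 'I_Q -> params R n m)
         (d : measure_display) (T : measurableType d)
         (P : 'I_Q -> probability T R)
         (e : forall q : 'I_Q, nat -> 'I_n -> {RV (P q) >-> R})
         (perms : 'I_Q -> 'I_D -> seq (inputs n m H)) (Y : output H),
  (forall q : 'I_Q, gaussian_noise H (Sigma (w q)) (e q)) ->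
  (forall (q : 'I_Q) (k : 'I_D), perm_eq (perms q k) (enum {: inputs n m H})) ->
  [/\ (forall o : inputs n m H,
         result (shapley_recursive M w Y perms) o =
         shapley_estimator (fun q => value_fun M (w q) (e q) Y) perms o),
      (cost (shapley_recursive M w Y perms)
         <= C * (Q * D * H ^ 2 * (n ^ 4 * m + n ^ 3 * m ^ 2)))%N,
      (forall o : inputs n m H,
         result (shapley_brute M w Y perms) o =
         shapley_estimator (fun q => value_fun M (w q) (e q) Y) perms o) &
      (cost (shapley_brute M w Y perms)
         <= C * (Q * D * H ^ 3 * (n ^ 4 * m + n ^ 3 * m ^ 2)))%N].
Proof.
(* 168 = 7 * 24, from the estimator and from one evaluation; moreover Hnm * n^2 (n + m) = H (n^4 m +
   n^3 m^2). *)
exists 168%N => R n m H Q D n_gt0 m_gt0 H_gt0 Q_gt0 D_gt0 M w d T P e perms Y.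
move=> eP permsP.
have N_gt0 : (0 < n ^ 2 * (n + m))%N.
  by rewrite muln_gt0 expn_gt0 addn_gt0 n_gt0.
(* The evaluation bound must also dominate the output dimension, [n] or 1. It is used with [k] equal
   to [H] and to [H ^ 2]. *)
have le_dim k : (0 < k)%N ->
    (0 < 24 * (k * (n ^ 2 * (n + m))) /\
     odim n Y <= 24 * (k * (n ^ 2 * (n + m))))%N.
  move=> k_gt0; have kN_gt0 : (0 < k * (n ^ 2 * (n + m)))%N.
    by rewrite muln_gt0 k_gt0.
  split; first by lia.
  have le_nN : (n <= n ^ 2 * (n + m))%N by rewrite -mulnn -mulnA; nia.
  have : (n ^ 2 * (n + m) <= k * (n ^ 2 * (n + m)))%N by rewrite leq_pmull.
  by case: Y => [t|] /=; lia.
have valueE : (fun q => value_fun M (w q) (e q) Y) =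
    (fun q U => mean_outcome M (w q) (theta_on (theta M) U) Y).
  by apply/funext => q; apply/funext => U; apply: value_funE.
rewrite valueE; split=> [x||x|].
- rewrite result_shapley_algorithm//; congr (shapley_estimator _ _ _).
  by apply/funext => q; apply/funext => U; apply: result_eval_recursive.
- have [c_gt0 le_pc] := le_dim H H_gt0.
  apply: leq_trans (leq_cost_shapley_algorithm permsP n_gt0 m_gt0 H_gt0
    Q_gt0 D_gt0 le_pc c_gt0 _) _ => [q U|].
    exact: leq_cost_eval_recursive.
  by lia.
- rewrite result_shapley_algorithm//; congr (shapley_estimator _ _ _).
  by apply/funext => q; apply/funext => U; apply: result_eval_brute.
have H2_gt0 : (0 < H ^ 2)%N by rewrite expn_gt0 H_gt0.
have [c_gt0 le_pc] := le_dim (H ^ 2)%N H2_gt0.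
apply: leq_trans (leq_cost_shapley_algorithm permsP n_gt0 m_gt0 H_gt0
  Q_gt0 D_gt0 le_pc c_gt0 _) _ => [q U|].
  exact: leq_cost_eval_brute.
by lia.
Qed.
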